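(* For any closed concave $H:\Delta_k\to\mathbb{R}\cup\{-\infty\}$, the losses $$L(\cdot,i):\mathbb{R}^k\to\mathbb{R}\cup\{+\infty\},\qquad L(\alpha,i)=-\alpha_i+(-H)^*(\alpha),\qquad i\in\{1,\ldots,k\},$$ are closed, convex, and satisfy $$H(\pi)=\inf_{\alpha\in\mathbb{R}^k}\Big\{\sum_{i=1}^k\pi_iL(\alpha,i)\Big\}\quad\text{for all }\pi\in\Delta_k.$$
   Context: $\Delta_k=\{p\in\mathbb{R}^k_+ : \mathbf{1}^Tp=1\}$. A convex function is closed if its epigraph is closed; a concave function $H$ is closed if $-H$ is closed. $H$ is regarded as $-\infty$ outside $\Delta_k$, and $f^*(s)=\sup_t\{s^Tt-f(t)\}$ is the Fenchel conjugate, so $(-H)^*(\alpha)=\sup_{\pi\in\Delta_k}\{\alpha^T\pi+H(\pi)\}$.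
   Formalization: The claim that the losses take values in R∪{+∞} is stated only for H not identically −∞, since for H ≡ −∞ the losses are identically −∞; closedness, convexity and the formula for H are stated for every closed concave H. *)

(* Defs.v *)
From HB Require Import structures.
From mathcomp Require Import all_boot all_order all_algebra.
From mathcomp Require Import all_classical all_reals all_analysis.

Set Implicit Arguments.
Unset Strict Implicit.
Unset Printing Implicit Defensive.

Import Order.TTheory GRing.Theory Num.Theory.
Import numFieldNormedType.Exports.

Local Open Scope classical_set_scope.
Local Open Scope ring_scope.

Definition prob_simplex (R : realType) (k : nat) : set 'rV[R]_k :=
  [set p | (forall i, 0 <= p ord0 i) /\ \sum_(i < k) p ord0 i = 1].

Definition dotv (R : realType) (k : nat) (s t : 'rV[R]_k) : R :=
  \sum_(i < k) s ord0 i * t ord0 i.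

Definition epigraph (R : realType) (k : nat) (f : 'rV[R]_k -> \bar R)
    : set ('rV[R]_k * R) :=
  [set xt | (f xt.1 <= xt.2%:E)%E].

Definition closed_fun (R : realType) (k : nat) (f : 'rV[R]_k -> \bar R) : Prop :=
  closed (epigraph f).

(* Analogue for extended-real functions of [convex_function], which is for
   real-valued ones. The conventions 0 * +oo = 0 and -oo + +oo = -oo matter only
   at the endpoints of [0, 1], resp. for functions taking both infinite values. *)
Definition convex_fun (R : realType) (k : nat) (f : 'rV[R]_k -> \bar R) : Prop :=
  forall (x y : 'rV[R]_k) (t : R), 0 <= t <= 1 ->
    (f ((t *: x + (1 - t) *: y)%R) <= t%:E * f x + (1 - t)%:E * f y)%E.

Definition concave_fun (R : realType) (k : nat) (f : 'rV[R]_k -> \bar R) : Prop :=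
  convex_fun (fun x => - f x)%E.

Definition closed_concave_fun (R : realType) (k : nat)
    (f : 'rV[R]_k -> \bar R) : Prop :=
  concave_fun f /\ closed_fun (fun x => - f x)%E.

(* An extended-real function on the simplex with no value +oo, represented by
   its extension by -oo to the whole space. *)
Definition simplex_fun (R : realType) (k : nat) (H : 'rV[R]_k -> \bar R) : Prop :=
  (forall p, H p != +oo%E) /\
  (forall p, ~ prob_simplex p -> H p = -oo%E).

Definition fenchel_conj (R : realType) (k : nat) (f : 'rV[R]_k -> \bar R)
    (s : 'rV[R]_k) : \bar R :=
  ereal_sup [set ((dotv s t)%:E - f t)%E | t in [set: 'rV[R]_k]].

Definition loss (R : realType) (k : nat) (H : 'rV[R]_k -> \bar R)
    (alpha : 'rV[R]_k) (i : 'I_k) : \bar R :=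
  ((- alpha ord0 i)%:E + fenchel_conj (fun p => - H p) alpha)%E.

(* Main.v *)
Require Import Defs.
From HB Require Import structures.
From mathcomp Require Import all_boot all_order all_algebra.
From mathcomp Require Import all_classical all_reals all_analysis.
From mathcomp Require Import ring lra.

Set Implicit Arguments.
Unset Strict Implicit.
Unset Printing Implicit Defensive.

Import Order.TTheory GRing.Theory Num.Theory.
Import numFieldNormedType.Exports.

Local Open Scope classical_set_scope.
Local Open Scope ring_scope.

(** With [f := - H], a closed convex function equal to [+oo] outside the
    compact simplex, the weights of [p] in the simplex sum to one, so
    [\sum_i p_i L(alpha, i) = f^*(alpha) - <p, alpha>] ([weighted_loss]).
    Minimising over [alpha] yields [- f^**(p)], and the representation of [H]
    is the Fenchel-Moreau identity [f^** = f]. Each loss is a linear function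
    plus [f^*], a supremum of affine functions, hence closed and convex.

    Compactness of the domain gives a proof of Fenchel-Moreau without
    separating hyperplanes ([affine_minorant]). Given a real [r < f p], minimise
    [f + mu |. - p|^2]; closedness and compactness provide a minimiser [x].
    Moving from [x] towards [q] along a segment, convexity of [f] gives
    [f q >= f x - 2 mu <x - p, q - x>]: an affine minorant of [f], whose value
    at [p] is [f x + 2 mu |x - p|^2]. That value is at least [r] when [mu] is
    large: either [f x > r], or [x] lies in the compact set where [f <= r],
    which stays at positive distance from [p], while [f] is bounded below.
    The argument needs no distinction between points inside and outside the
    effective domain of [f], and so no treatment of vertical hyperplanes. *)

(** * The bilinear form [dotv] and its continuity *)

Lemma dotvC (R : realType) (k : nat) (x y : 'rV[R]_k) : dotv x y = dotv y x.
Proof. by apply: eq_bigr => i _; rewrite mulrC. Qed.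

Lemma dotvDl (R : realType) (k : nat) (x y z : 'rV[R]_k) :
  dotv (x + y) z = dotv x z + dotv y z.
Proof.
by rewrite /dotv -big_split; apply: eq_bigr => i _; rewrite mxE mulrDl.
Qed.

Lemma dotvZl (R : realType) (k : nat) (a : R) (x z : 'rV[R]_k) :
  dotv (a *: x) z = a * dotv x z.
Proof.
by rewrite /dotv mulr_sumr; apply: eq_bigr => i _; rewrite mxE mulrA.
Qed.

Lemma dotvBl (R : realType) (k : nat) (x y z : 'rV[R]_k) :
  dotv (x - y) z = dotv x z - dotv y z.
Proof. by rewrite dotvDl -scaleN1r dotvZl mulN1r. Qed.

Lemma dotvDr (R : realType) (k : nat) (x y z : 'rV[R]_k) :
  dotv x (y + z) = dotv x y + dotv x z.
Proof. by rewrite !(dotvC x) dotvDl. Qed.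

Lemma dotvZr (R : realType) (k : nat) (a : R) (x z : 'rV[R]_k) :
  dotv x (a *: z) = a * dotv x z.
Proof. by rewrite !(dotvC x) dotvZl. Qed.

Lemma dotv_ge0 (R : realType) (k : nat) (x : 'rV[R]_k) : 0 <= dotv x x.
Proof. by apply: sumr_ge0 => i _; rewrite -expr2 sqr_ge0. Qed.

Lemma dotv_eq0 (R : realType) (k : nat) (x : 'rV[R]_k) :
  (dotv x x == 0) = (x == 0).
Proof.
apply/eqP/eqP => [/eqP|->]; last first.
  by apply: big1 => i _; rewrite mxE mul0r.
rewrite psumr_eq0 => [/allP x0|i _]; last by rewrite -expr2 sqr_ge0.
apply/rowP => i; rewrite mxE; apply/eqP.
by have := x0 i (mem_index_enum i); rewrite mulf_eq0 orbb.
Qed.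

Lemma dotv_continuous (R : realType) (k : nat) (T : topologicalType)
    (u v : T -> 'rV[R]_k) :
  continuous u -> continuous v -> continuous (fun x => dotv (u x) (v x)).
Proof.
move=> cu cv; have cD : continuous (fun z : R * R => z.1 + z.2).
  by move=> z; apply: cvgD; [exact: cvg_fst|exact: cvg_snd].
apply: (continuous_big (P := predT) cD) => i _ x.
have coord w : continuous w ->
    (w y : 'rV[R]_k) ord0 i @[y --> x] --> w x ord0 i.
  by move=> cw; exact: (cvg_comp _ _ (cw x) (@coord_continuous _ _ _ _ _ _)).
by apply: cvgM; exact: coord.
Qed.

(** The topology on row vectors unfolds to a form in which instances of
    [Filter] are no longer found; an abstract domain [T] keeps it folded. *)
Lemma sqdist_continuous (R : realType) (k : nat) (T : topologicalType)
    (u v : T -> 'rV[R]_k) : continuous u -> continuous v ->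
  continuous (fun x => dotv (u x - v x) (u x - v x)).
Proof.
move=> cu cv; have cB : continuous (fun x => u x - v x).
  by move=> x; exact: (@cvgB R 'rV[R]_k _ _ _ u v _ _ (cu x) (cv x)).
exact: dotv_continuous.
Qed.

Lemma continuous_pair (T U V : topologicalType) (u : T -> U) (v : T -> V) :
  continuous u -> continuous v -> continuous (fun x => (u x, v x)).
Proof. by move=> cu cv x; exact: (cvg_pair (cu x) (cv x)). Qed.

(** * Minimising lower semicontinuous functions *)

Lemma lsc_closed_sublevel (R : realType) (T : topologicalType)
    (g : T -> \bar R) (a : R) :
  lower_semicontinuous g -> closed [set x | (g x <= a%:E)%E].
Proof.
move=> /lower_semicontinuousP og.
rewrite (_ : [set _ | _] = ~` [set x | (a%:E < g x)%E]).
  exact/open_closedC/og.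
by apply/seteqP; split=> x /=; rewrite leNgt => /negP.
Qed.

(** The sublevel sets through the points of [K] are totally ordered by
    inclusion, so they generate a filter on [K]; a cluster point of it belongs
    to all of them because they are closed. A point where [g] is [-oo], whose
    sublevel set comes from no real level, is itself a minimiser. *)
Lemma lsc_compact_min (R : realType) (T : topologicalType) (K : set T)
    (g : T -> \bar R) :
  compact K -> K !=set0 -> lower_semicontinuous g ->
  exists2 x, K x & forall y, K y -> (g x <= g y)%E.
Proof.
move=> cK [x0 Kx0] lscg.
have [[y Ky gy]|gNy] := pselect (exists2 y, K y & g y = -oo%E).
  by exists y => // z _; rewrite gy leNye.
pose B y := K `&` [set x | (g x <= g y)%E].
have clB y : K y -> closed [set x | (g x <= g y)%E].
  move=> Ky; case gyE : (g y) => [a| |].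
  - exact: lsc_closed_sublevel.
  - rewrite (_ : [set _ | _] = setT); first exact: closedT.
    by apply/seteqP; split => x //= _; exact: leey.
  - by case: gNy; exists y.
have fB : ProperFilter (filter_from K B).
  apply: filter_from_proper => [|y Ky]; last by exists y; split => //=.
  apply: filter_from_filter; first by exists x0.
  move=> y z Ky Kz; have [yz|zy] := leP (g y) (g z).
    by exists y => // x [Kx xy]; split; split => //; exact: le_trans yz.
  by exists z => // x [Kx xz]; split; split => //; exact/(le_trans xz)/ltW.
have [|x [Kx clx]] := cK _ fB; first by exists x0 => // x [].
exists x => // y Ky; apply: (clB y Ky) => U Ux.
have [z [[_ zy] Uz]] := clx (B y) U (ex_intro2 _ _ y Ky (fun _ h => h)) Ux.
by exists z.
Qed.

(** * Closed functions, convex functions and conjugates *)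

Lemma closed_fun_lsc (R : realType) (k : nat) (f : 'rV[R]_k -> \bar R) :
  closed_fun f -> lower_semicontinuous f.
Proof.
move=> cf; apply/lower_semicontinuousP => a.
rewrite (_ : [set _ | _] = ~` ((fun x => (x, a)) @^-1` epigraph f)).
  apply: closed_openC; apply: preimage_closed => // x _.
  by apply: continuous_pair => z; [exact: cvg_id|exact: cst_continuous].
by apply/seteqP; split=> x /=; rewrite /epigraph/= ltNge => /negP.
Qed.

(** The epigraph of [h + f] is the image of that of [f] under the vertical
    shear by [h], a homeomorphism. *)
Lemma closed_fun_addl (R : realType) (k : nat) (h : 'rV[R]_k -> R)
    (f : 'rV[R]_k -> \bar R) :
  continuous h -> closed_fun f -> closed_fun (fun x => (h x)%:E + f x)%E.
Proof.
move=> ch cf; rewrite /closed_fun.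
rewrite (_ : epigraph _ = (fun xt => (xt.1, xt.2 - h xt.1)) @^-1` epigraph f).
  apply: preimage_closed => // xt _.
  apply: continuous_pair => z; first exact: cvg_fst.
  apply: cvgB; first exact: cvg_snd.
  by apply: (@continuous_comp _ _ _ fst h); [exact: cvg_fst|exact: ch].
by apply/seteqP; split=> -[x t]; rewrite /epigraph/= EFinB leeBrDl.
Qed.

Lemma convex_fun_addl (R : realType) (k : nat) (h : 'rV[R]_k -> R)
    (f : 'rV[R]_k -> \bar R) :
  (forall x y t, h (t *: x + (1 - t) *: y) = t * h x + (1 - t) * h y) ->
  convex_fun f -> convex_fun (fun x => (h x)%:E + f x)%E.
Proof.
move=> hA cf x y t t01.
rewrite hA !muleDr// ?fin_num_adde_defr// addeACA -!EFinM -EFinD.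
exact/leeD2l/cf.
Qed.

(** The epigraph of a conjugate is the intersection of one closed set for each
    point [q]: a half-space where [f q] is real, everything where it is [+oo],
    nothing where it is [-oo]. *)
Lemma closed_fenchel_conj (R : realType) (k : nat) (f : 'rV[R]_k -> \bar R) :
  closed_fun (fenchel_conj f).
Proof.
rewrite /closed_fun (_ : epigraph _ =
  \bigcap_(q in [set: 'rV[R]_k])
    [set st | ((dotv st.1 q)%:E - f q <= st.2%:E)%E]).
  apply: closed_bigI => q _; case: (f q) => [a| |] /=.
  - rewrite (_ : [set _ | _] =
        (fun st => dotv st.1 q - st.2) @^-1` [set y | y <= a]).
      apply: preimage_closed; last exact: closed_le.
      move=> st _; apply: cvgB; last exact: cvg_snd.
      apply: (dotv_continuous (u := fst) (v := fun=> q)) => z.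
        exact: cvg_fst.
      exact: cst_continuous.
    by apply/seteqP; split=> -[s t] /=; rewrite -EFinB lee_fin; lra.
  - rewrite (_ : [set _ | _] = setT); first exact: closedT.
    by apply/seteqP; split => x //= _; exact: leNye.
  - by rewrite (_ : [set _ | _] = set0); [exact: closed0|apply/seteqP; split].
apply/seteqP; split=> -[s t] /=; rewrite /epigraph/=.
  by move=> st q _ /=; apply: le_trans st; apply: ereal_sup_ubound; exists q.
by move=> st; apply: ge_ereal_sup => _ [q _ <-]; exact: (st q).
Qed.

Lemma convex_fenchel_conj (R : realType) (k : nat) (f : 'rV[R]_k -> \bar R) :
  convex_fun (fenchel_conj f).
Proof.
move=> x y t /andP[t0 t1]; apply: ge_ereal_sup => _ [q _ <-].
have t1' : 0 <= 1 - t by rewrite subr_ge0.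
have ub z : ((dotv z q)%:E - f q <= fenchel_conj f z)%E.
  by apply: ereal_sup_ubound; exists q.
apply: (@le_trans _ _ (t%:E * ((dotv x q)%:E - f q) +
    (1 - t)%:E * ((dotv y q)%:E - f q))%E); last first.
  by apply: leeD; apply: lee_wpmul2l; rewrite ?lee_fin.
case: (f q) => [a| |] /=; rewrite ?leNye//.
  by rewrite -!EFinB -!EFinM -EFinD lee_fin dotvDl !dotvZl; lra.
rewrite -ge0_muleDl ?lee_fin// -EFinD subrKC mul1e.
exact: leey.
Qed.

(** * The Fenchel-Moreau theorem on a compact domain *)

Lemma compact_prob_simplex (R : realType) (k : nat) :
  compact (prob_simplex (R := R) (k := k)).
Proof.
have cI : compact [set v : 'rV[R]_k | forall i, `[0, 1]%classic (v ord0 i)].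
  exact: (@rV_compact R k (fun=> `[0, 1]%classic)
    (fun=> @segment_compact R 0 1)).
apply: (subclosed_compact _ cI) => [|p [p0 p1] i] /=; last first.
  rewrite in_itv/= p0/= -p1 (bigD1 i)//= lerDl.
  by apply: sumr_ge0 => j _; exact: p0.
rewrite (_ : prob_simplex (k := k) =
    (\bigcap_(i in [set: 'I_k]) [set p : 'rV[R]_k | 0 <= p ord0 i]) `&`
    [set p : 'rV[R]_k | dotv (const_mx 1) p = 1]).
  apply: closedI.
    apply: closed_bigI => i _.
    apply: (@preimage_closed _ _ (fun p : 'rV[R]_k => p ord0 i)
        [set y | 0 <= y]).
      by move=> p _; exact: coord_continuous.
    exact: closed_ge.
  apply: (@preimage_closed _ _ (dotv (const_mx 1)) [set 1]) => [p _|].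
    apply: (dotv_continuous (u := fun=> const_mx 1) (v := id)) => z.
      exact: cst_continuous.
    exact: cvg_id.
  exact: closed_eq.
have dotv1 p : dotv (const_mx 1) p = \sum_(i < k) p ord0 i.
  by apply: eq_bigr => i _; rewrite mxE mul1r.
apply/seteqP; split=> p /=; rewrite dotv1 => -[p0 p1]; split => // i.
  by move=> _; exact: p0.
exact: (p0 i I).
Qed.

(** First-order optimality: [A] is the derivative at [0] of
    [s |-> s * A + s ^+ 2 * B]. *)
Lemma ge0_of_quadratic_ge0 (R : realFieldType) (A B : R) : 0 <= B ->
  (forall s, 0 < s <= 1 -> 0 <= s * A + s ^+ 2 * B) -> 0 <= A.
Proof.
move=> B0 AB; rewrite leNgt; apply/negP => A0.
have BA : 0 < B - A by lra.
(* The parabola is negative between [0] and [- A / B]; the denominator [B - A]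
   is nonzero even if [B = 0] and keeps the step at most [1]. *)
have s01 : 0 < - A / (B - A) <= 1.
  by rewrite divr_gt0 ?oppr_gt0//= ler_pdivrMr// mul1r; lra.
have /AB := s01; move: s01 => /andP[s0 _].
have : - A / (B - A) * (B - A) = - A by rewrite divfK// gt_eqF.
move: (- A / (B - A)) s0 => s s0 sBA.
by rewrite expr2 -mulrA -mulrDr pmulr_rge0//; nra.
Qed.

(** The minorant is read off at a minimiser [x] of [f + mu |. - p|^2], with
    slope [- 2 mu (x - p)]; it replaces separation of the point [(p, r)] from
    the epigraph of [f]. *)
Lemma affine_minorant (R : realType) (k : nat) (K : set 'rV[R]_k)
    (f : 'rV[R]_k -> \bar R) (p : 'rV[R]_k) (r : R) :
  compact K -> (forall x, ~ K x -> f x = +oo%E) -> (forall x, f x != -oo%E) ->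
  convex_fun f -> closed_fun f -> (r%:E < f p)%E ->
  exists alpha, forall q, ((r + dotv alpha (q - p))%:E <= f q)%E.
Proof.
move=> cK fK fNy cvf clf rfp.
have lscf := closed_fun_lsc clf.
have sqc : continuous (fun x : 'rV[R]_k => dotv (x - p) (x - p)).
  apply: (@sqdist_continuous _ _ _ id (fun=> p)) => x; first exact: cvg_id.
  exact: cst_continuous.
have [K0|K0] := pselect (K !=set0); last first.
  by exists 0 => q; rewrite fK ?leey// => Kq; apply: K0; exists q.
have [x0 Kx0 minf] := lsc_compact_min cK K0 lscf.
case fx0 : (f x0) => [m| |]; last 2 first.
- exists 0 => q; have [Kq|/fK->] := pselect (K q); last exact: leey.
  by have := minf q Kq; rewrite fx0 leye_eq => /eqP ->; exact: leey.
- by have := fNy x0; rewrite fx0.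
have mf q : (m%:E <= f q)%E.
  by have [/minf|/fK->] := pselect (K q); rewrite ?fx0 ?leey.
(* The points where [f <= r] stay away from [p], at squared distance [d]. *)
have [d d0 dC] : exists2 d, 0 < d &
    forall q, (f q <= r%:E)%E -> d <= dotv (q - p) (q - p).
  pose C := [set q | (f q <= r%:E)%E].
  have CK : C `<=` K.
    by move=> q Cq; apply: contrapT => /fK fq; move: Cq; rewrite /C/= fq.
  have cC : compact C.
    by apply: (subclosed_compact _ cK CK); exact: lsc_closed_sublevel.
  have [C0|C0] := pselect (C !=set0); last first.
    by exists 1 => // q Cq; case: C0; exists q.
  have [c /set_mem Cc minc] := compact_EVT_min C0 cC (continuous_subspaceT sqc).
  exists (dotv (c - p) (c - p)) => [|q Cq]; last exact/minc/mem_set.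
  rewrite lt_neqAle dotv_ge0 andbT eq_sym dotv_eq0 subr_eq0.
  by apply: contraTneq rfp => <-; rewrite -leNgt.
(* At squared distance [d] the penalty lifts the lower bound [m] to [r]. *)
pose mu := `|r - m| / d.
have mu0 : 0 <= mu by rewrite divr_ge0// ltW.
have mud : mu * d = `|r - m| by rewrite divfK// gt_eqF.
have [x Kx ming] := lsc_compact_min cK K0 (closed_fun_lsc (closed_fun_addl
  (h := fun x : 'rV[R]_k => mu * dotv (x - p) (x - p))
  (fun z => continuous_comp (sqc z) (@mulrl_continuous _ mu _)) clf)).
case fx : (f x) (fNy x) => [c| |] // _; last first.
  by have := ming x0 Kx0; rewrite fx fx0.
set v := x - p in ming.
(* Compare [x] with the points [x + s (q - x)] for small [s]. *)
have minx q b : f q = b%:E -> 0 <= b - c + mu *+ 2 * dotv v (q - x).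
  move=> fq; set w := q - x.
  apply: (@ge0_of_quadratic_ge0 _ _ (mu * dotv w w)) => [|s /andP[s0 s1]].
    by rewrite mulr_ge0// dotv_ge0.
  have := cvf q x s; rewrite (ltW s0) s1 fq fx => /(_ isT).
  set y := s *: q + (1 - s) *: x; rewrite -!EFinM -EFinD.
  case fy : (f y) (fNy y) => [e| |] // _; rewrite lee_fin => ye.
  have Ky : K y by apply: contrapT => /fK; rewrite fy.
  have := ming y Ky; rewrite fx fy -!EFinD lee_fin.
  have -> : y - p = v + s *: w.
    by apply/rowP => i; rewrite !mxE; ring.
  clearbody v w; rewrite !(dotvDl, dotvDr, dotvZl, dotvZr) (dotvC w v).
  by lra.
exists (- (mu *+ 2) *: v) => q.
case fq : (f q) (fNy q) => [b| |] // _; last exact: leey.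
rewrite lee_fin (_ : q - p = v + (q - x)); last first.
  by apply/rowP => i; rewrite !mxE; ring.
rewrite dotvZl dotvDr; have := minx q b fq.
have vv : 0 <= dotv v v := dotv_ge0 v.
suff : r <= c + mu *+ 2 * dotv v v by lra.
have [cr|rc] := leP c r; last first.
  by apply: (le_trans (ltW rc)); rewrite lerDl mulr_ge0// mulrn_wge0.
have dv : d <= dotv v v by apply: dC; rewrite fx.
have := mf x; rewrite fx lee_fin => mc.
have := ler_wpM2l mu0 dv; rewrite mud => rm.
have := ler_norm (r - m).
have : 0 <= mu * dotv v v by rewrite mulr_ge0.
by lra.
Qed.

Lemma lee_real_below (R : realFieldType) (x y : \bar R) :
  (forall r : R, (r%:E < x)%E -> (r%:E <= y)%E) -> (x <= y)%E.
Proof.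
move=> rxy; rewrite leNgt; apply/negP => yx.
suff [r yr rx] : exists2 r : R, (y < r%:E)%E & (r%:E < x)%E.
  by have := rxy r rx; rewrite leNgt yr.
case: x y yx {rxy} => [x| |] [y| |] //= yx.
- by exists ((x + y) / 2); rewrite lte_fin; move: yx; rewrite lte_fin; lra.
- by exists (x - 1); rewrite ?ltNyr// lte_fin; lra.
- by exists (y + 1); rewrite ?ltry// lte_fin; lra.
- by exists 0; rewrite ?ltNyr ?ltry.
Qed.

(** The inequality [f^** <= f] is Fenchel-Young; the converse tests the outer
    supremum on the slopes of affine minorants. The case [f = +oo] everywhere is
    covered, with [f^* = -oo]. *)
Lemma fenchel_biconj (R : realType) (k : nat) (K : set 'rV[R]_k)
    (f : 'rV[R]_k -> \bar R) :
  compact K -> (forall x, ~ K x -> f x = +oo%E) -> (forall x, f x != -oo%E) ->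
  convex_fun f -> closed_fun f -> fenchel_conj (fenchel_conj f) = f.
Proof.
move=> cK fK fNy cvf clf; apply/funext => p; apply/eqP; rewrite eq_le.
apply/andP; split.
  apply: ge_ereal_sup => _ [alpha _ <-].
  have : ((dotv alpha p)%:E - f p <= fenchel_conj f alpha)%E.
    by apply: ereal_sup_ubound; exists p.
  rewrite dotvC; case: (f p) (fNy p) => [b| |] // _; last by rewrite leey.
  case: (fenchel_conj f alpha) => [c| |] //=; rewrite ?leNye//.
  by rewrite -!EFinB !lee_fin; lra.
apply: lee_real_below => r /(affine_minorant cK fK fNy cvf clf)[alpha minor].
apply: (@le_trans _ _ ((dotv p alpha)%:E - fenchel_conj f alpha)%E); last first.
  by apply: ereal_sup_ubound; exists alpha.
have : (fenchel_conj f alpha <= (dotv alpha p - r)%:E)%E.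
  apply: ge_ereal_sup => _ [q _ <-]; have := minor q.
  case: (f q) (fNy q) => [b| |] // _; last by rewrite leNye.
  by rewrite -EFinB !lee_fin dotvC dotvBl !(dotvC alpha); lra.
rewrite dotvC; case: (fenchel_conj f alpha) => [c| |] //=; last by rewrite leey.
by rewrite -EFinB !lee_fin; lra.
Qed.

(** * Losses built from a concave function *)

(** The sum is legitimate even when the conjugate is infinite, because a
    nonnegative combination of copies of one extended real distributes. *)
Lemma weighted_loss (R : realType) (k : nat) (H : 'rV[R]_k -> \bar R)
    (p alpha : 'rV[R]_k) : prob_simplex p ->
  (\sum_(i < k) (p ord0 i)%:E * loss H alpha i =
   (- dotv p alpha)%:E + fenchel_conj (fun q => - H q) alpha)%E.
Proof.
move=> [p0 p1]; rewrite /loss.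
under eq_bigr do rewrite muleDr// ?fin_num_adde_defr// -EFinM mulrN.
rewrite big_split /= sumEFin sumrN; congr (_ + _)%E.
by rewrite -ge0_sume_distrl ?sumEFin ?p1 ?mul1e// => i _; rewrite lee_fin.
Qed.

Theorem proposition3 (R : realType) (k : nat) (H : 'rV[R]_k -> \bar R)
    (hH : simplex_fun H) (hHcc : closed_concave_fun H) :
  (forall i : 'I_k,
     [/\ (exists p, H p != -oo%E) -> forall alpha, loss H alpha i != -oo%E,
         closed_fun (fun alpha => loss H alpha i)
       & convex_fun (fun alpha => loss H alpha i)]) /\
  (forall p, prob_simplex p ->
     H p = ereal_inf [set (\sum_(i < k) (p ord0 i)%:E * loss H alpha i)%E
                     | alpha in [set: 'rV[R]_k]]).
Proof.
case: hH hHcc => Hy Hout [cvH clH]; split.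
  move=> i; split.
  (* A single point [q] where [H] is finite bounds the conjugate below. *)
  - move=> [q Hq] alpha; rewrite /loss -ltNye.
    apply: (@lt_le_trans _ _
      ((- alpha ord0 i)%:E + ((dotv alpha q)%:E - - H q))%E).
      by case: (H q) Hq (Hy q) => [a| |] //= _ _; rewrite ltNyr.
    by apply: leeD2l; apply: ereal_sup_ubound; exists q.
  - apply: closed_fun_addl; last exact: closed_fenchel_conj.
    move=> alpha.
    apply: (@continuous_comp _ _ _ (fun a : 'rV_k => a ord0 i) -%R).
      exact: coord_continuous.
    exact: opp_continuous.
  - apply: convex_fun_addl; last exact: convex_fenchel_conj.
    by move=> x y t; rewrite !mxE; ring.
move=> p pS.
have <- : (- fenchel_conj (fenchel_conj (fun q => - H q)) p = H p)%E.
  rewrite (fenchel_biconj (@compact_prob_simplex R k)) ?oppeK// => q.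
    by move=> /Hout ->.
  by rewrite eqe_oppLR.
rewrite /ereal_inf; congr (- ereal_sup _)%E.
rewrite image_comp; apply: eq_imagel => alpha _ /=.
by rewrite weighted_loss// oppeD ?fin_num_adde_defr// EFinN oppeK.
Qed.
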